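(* Let $x$ be an indeterminate. For $\nu\in\{0,1,2\}$ define the formal power series in $z$ (with coefficients in $\mathbb{Q}[x]$) $$F^{(\nu)}(z) := \sum_{k=0}^{\infty}E_{2k+\nu}\!\left(\tfrac{x+1}{2}\right)z^{2k},$$ where $E_m(\cdot)$ is the $m$th Euler polynomial, and let $$\sigma_{n}^{(\nu)}=(2n+1)\left(n+\tfrac{\nu}{2}\right)-\frac{x^{2}-1}{4}\quad(n\ge0),\qquad \tau_{n}^{(\nu)}=\frac{n^{2}}{4}\left(x^{2}-(2n+\nu-1)^{2}\right)\quad(n\ge1).$$ Then for $\nu=0,1,2$, as formal power series in $z$, $$F^{(\nu)}(z)=\cfrac{E_{\nu}\!\left(\tfrac{x+1}{2}\right)}{1+\sigma_{0}^{(\nu)}z^{2}+\cfrac{\tau_{1}^{(\nu)}z^{4}}{1+\sigma_{1}^{(\nu)}z^{2}+\cfrac{\tau_{2}^{(\nu)}z^{4}}{1+\sigma_2^{(\nu)}z^2+\ddots}}}.$$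
   Context: The Euler polynomials are defined by $\frac{2e^{xt}}{e^t+1}=\sum_{n\ge 0}E_n(x)\frac{t^n}{n!}$. The infinite continued fraction is understood as a formal power series: it is the limit, in the usual ($z$-adic) topology on formal power series, of its finite truncations, obtained by terminating the fraction at the denominator $1+\sigma_N^{(\nu)} z^2$ and letting $N\to\infty$. *)

(* Defs.v *)
From HB Require Import structures.
From mathcomp Require Import all_boot all_order all_algebra.
From mathcomp Require Import boolp.

Set Implicit Arguments.
Unset Strict Implicit.
Unset Printing Implicit Defensive.

Import GRing.Theory.
Local Open Scope ring_scope.

(* [f : fps R] stands for the series \sum_n f n z^n; [f n] is its n-th
   coefficient. *)
Record fps (R : Type) := Fps { fps_coef :> nat -> R }.

Lemma fpsP (R : Type) (f g : fps R) : f =1 g -> f = g.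
Proof. by case: f g => [f] [g] /funext /= ->. Qed.

Lemma fps_coefK (R : Type) : cancel (@fps_coef R) (@Fps R).
Proof. by case. Qed.

HB.instance Definition _ (R : choiceType) := gen_eqMixin (fps R).
HB.instance Definition _ (R : choiceType) := gen_choiceMixin (fps R).

Section Zmodule.
Variable R : zmodType.
Implicit Types f g h : fps R.

Definition fps_zero : fps R := Fps (fun _ => 0).
Definition fps_opp f : fps R := Fps (fun n => - f n).
Definition fps_add f g : fps R := Fps (fun n => f n + g n).

Fact fps_addA : associative fps_add.
Proof. by move=> f g h; apply: fpsP => n /=; rewrite addrA. Qed.
Fact fps_addC : commutative fps_add.
Proof. by move=> f g; apply: fpsP => n /=; rewrite addrC. Qed.
Fact fps_add0 : left_id fps_zero fps_add.
Proof. by move=> f; apply: fpsP => n /=; rewrite add0r. Qed.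
Fact fps_addN : left_inverse fps_zero fps_opp fps_add.
Proof. by move=> f; apply: fpsP => n /=; rewrite addNr. Qed.

HB.instance Definition _ :=
  GRing.isZmodule.Build (fps R) fps_addA fps_addC fps_add0 fps_addN.

End Zmodule.

Section Ring.
Variable R : comNzRingType.
Implicit Types f g h : fps R.

Definition fpsC (c : R) : fps R := Fps (fun n => c *+ (n == 0)%N).

Definition fpsX : fps R := Fps (fun n => (n == 1)%N%:R).

Definition fps_mul f g : fps R := Fps (fun n => \sum_(i < n.+1) f i * g (n - i)%N).

Definition fps_trunc n f : {poly R} := \poly_(i < n.+1) f i.

Lemma coef_fps_trunc n f i : (i <= n)%N -> (fps_trunc n f)`_i = f i.
Proof. by move=> le_in; rewrite coef_poly ltnS le_in. Qed.

Lemma coef_fps_trunc_mul n f g i : (i <= n)%N ->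
  (fps_trunc n f * fps_trunc n g)`_i = fps_mul f g i.
Proof.
move=> le_in; rewrite coefM; apply: eq_bigr => j _.
rewrite !coef_fps_trunc ?(leq_trans (leq_subr _ _)) //.
by rewrite (leq_trans _ le_in) // -ltnS.
Qed.

Fact fps_mulA : associative fps_mul.
Proof.
move=> f g h; apply: fpsP => n.
transitivity ((fps_trunc n f * (fps_trunc n g * fps_trunc n h))`_n).
  rewrite coefM; apply: eq_bigr => i _.
  by rewrite coef_fps_trunc_mul ?leq_subr // coef_fps_trunc // -ltnS.
rewrite mulrA coefM; apply: eq_bigr => i _.
by rewrite coef_fps_trunc_mul -1?ltnS // coef_fps_trunc // leq_subr.
Qed.

Fact fps_mulC : commutative fps_mul.
Proof.
move=> f g; apply: fpsP => n.
by rewrite -(@coef_fps_trunc_mul n) // mulrC coef_fps_trunc_mul.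
Qed.

Fact fps_mul1 : left_id (fpsC 1) fps_mul.
Proof.
move=> f; apply: fpsP => n /=.
rewrite big_ord_recl /= subn0 mul1r big1 ?addr0 // => i _.
by rewrite mulr0n mul0r.
Qed.

Fact fps_mulDl : left_distributive fps_mul (@fps_add R).
Proof.
move=> f g h; apply: fpsP => n /=.
by rewrite -big_split; apply: eq_bigr => i _; rewrite mulrDl.
Qed.

Fact fps_one_neq0 : fpsC 1 != fps_zero R.
Proof.
apply/eqP => /(congr1 (fun f : fps R => f 0)) /= /eqP.
by rewrite oner_eq0.
Qed.

HB.instance Definition _ := GRing.Zmodule_isComNzRing.Build (fps R)
  fps_mulA fps_mulC fps_mul1 fps_mulDl fps_one_neq0.

Lemma fps_coef0 n : (0 : fps R) n = 0. Proof. by []. Qed.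
Lemma fps_coef1 n : (1 : fps R) n = (n == 0)%N%:R. Proof. by []. Qed.
Lemma fps_coefD f g n : (f + g) n = f n + g n. Proof. by []. Qed.
Lemma fps_coefN f n : (- f) n = - f n. Proof. by []. Qed.
Lemma fps_coefM f g n : (f * g) n = \sum_(i < n.+1) f i * g (n - i)%N.
Proof. by []. Qed.

Lemma fps_coefMX f n : (fpsX * f) n = if n is m.+1 then f m else 0.
Proof.
rewrite fps_coefM; case: n => [|n]; first by rewrite big_ord1 mul0r.
rewrite big_ord_recl mul0r add0r big_ord_recl mul1r subn1 big1 ?addr0 // => i _.
by rewrite mul0r.
Qed.

(* Convergence in the z-adic topology: u N = l modulo z^n for all large N. *)
Definition fps_cvg (u : nat -> fps R) (l : fps R) : Prop :=
  forall n, exists N0, forall N, (N0 <= N)%N ->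
    exists q : fps R, u N - l = fpsX ^+ n * q.

End Ring.

Section UnitRing.
Variable R : comUnitRingType.
Implicit Types f g : fps R.

(* The first n+1 coefficients of 1/f, by the recursion
   f_0 g_n = - \sum_(i < n) f_(n - i) g_i. *)
Fixpoint fps_inv_seq f n : seq R :=
  if n is m.+1 then
    let s := fps_inv_seq f m in
    rcons s (- ((f 0)^-1 * \sum_(i < m.+1) f (m.+1 - i)%N * s`_i))
  else [:: (f 0)^-1].

Definition fps_unit : {pred fps R} := [pred f : fps R | f 0 \is a GRing.unit].

Definition fps_inv f : fps R :=
  if f \in fps_unit then Fps (fun n => (fps_inv_seq f n)`_n) else f.

Lemma size_fps_inv_seq f n : size (fps_inv_seq f n) = n.+1.
Proof. by elim: n => //= n IHn; rewrite size_rcons IHn. Qed.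

Lemma nth_fps_inv_seq f n i : (i <= n)%N ->
  (fps_inv_seq f n)`_i = (fps_inv_seq f i)`_i.
Proof.
elim: n => [|n IHn]; first by rewrite leqn0 => /eqP ->.
rewrite leq_eqVlt => /predU1P[-> //|lt_in] /=.
by rewrite nth_rcons size_fps_inv_seq lt_in IHn.
Qed.

Fact fps_mulVr : {in fps_unit, left_inverse 1 fps_inv *%R}.
Proof.
move=> f f_unit; apply: fpsP => n; rewrite mulrC /fps_inv f_unit.
rewrite inE in f_unit; rewrite fps_coefM fps_coef1.
case: n => [|n] /=; first by rewrite big_ord1 divrr.
rewrite big_ord_recl /= subn0 nth_rcons size_fps_inv_seq ltnn eqxx.
rewrite mulrN mulrA divrr // mul1r.
apply/eqP; rewrite addrC subr_eq0; apply/eqP.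
rewrite [RHS](reindex_inj rev_ord_inj) /=; apply: eq_bigr => i _.
have le_in : (i <= n)%N by rewrite -ltnS.
by rewrite /bump add1n !subSS subSn ?leq_subr // subKn // [in RHS]nth_fps_inv_seq ?leq_subr.
Qed.

Fact fps_unitPl f g : g * f = 1 -> fps_unit f.
Proof.
move=> /(congr1 (fun h : fps R => h 0)); rewrite fps_coefM big_ord1 subn0 /=.
by move=> gf1; apply/unitrPr; exists (g 0); rewrite mulrC.
Qed.

Fact fps_inv_out : {in [predC fps_unit], fps_inv =1 id}.
Proof. by move=> f; rewrite inE /fps_inv => /negbTE ->. Qed.

HB.instance Definition _ := GRing.ComNzRing_hasMulInverse.Build (fps R)
  fps_mulVr fps_unitPl fps_inv_out.

Lemma fps_unitE f : (f \is a GRing.unit) = (f 0 \is a GRing.unit).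
Proof. by []. Qed.

End UnitRing.

Section ContinuedFraction.
Variable K : comUnitRingType.

(* cfrac_denom a b n k is
     b n + a n.+1 / (b n.+1 + a n.+2 / (... + a (n + k) / b (n + k))). *)
Fixpoint cfrac_denom (a b : nat -> K) (n k : nat) : K :=
  if k is k'.+1 then b n + a n.+1 / cfrac_denom a b n.+1 k' else b n.

Definition cfrac (a b : nat -> K) (N : nat) : K := a 0 / cfrac_denom a b 0 N.

End ContinuedFraction.

(* e^(c t) as a series in t over Q[x]. *)
Definition fps_exp (c : {poly rat}) : fps {poly rat} :=
  Fps (fun n => (n`!%:R : rat)^-1 *: c ^+ n).

(* 2 e^(xt) / (e^t + 1) as a series in t, the variable x being 'X; a genuine
   division by euler_denom_unit. *)
Definition euler_gf : fps {poly rat} := 2 * fps_exp 'X / (fps_exp 1 + 1).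

Definition euler_poly (n : nat) : {poly rat} := (n`!%:R : rat) *: euler_gf n.

Lemma euler_denom_unit : fps_exp 1 + 1 \is a GRing.unit.
Proof.
rewrite fps_unitE fps_coefD fps_coef1 /= expr0 invr1 scale1r.
by rewrite -polyCD poly_unitE size_polyC coefC.
Qed.

Lemma euler_gfP :
  Fps (fun n => (n`!%:R : rat)^-1 *: euler_poly n) * (fps_exp 1 + 1)
    = 2 * fps_exp 'X.
Proof.
rewrite -[RHS](divrK euler_denom_unit) -/euler_gf; congr (_ * _).
apply: fpsP => n /=; rewrite scalerA mulVf ?scale1r //.
by rewrite Num.Theory.pnatr_eq0 -lt0n fact_gt0.
Qed.

(* E_m ((x + 1) / 2) *)
Definition euler_half (m : nat) : {poly rat} :=
  euler_poly m \Po ((2 : rat)^-1 *: ('X + 1)).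

(* Only even powers of z occur: the coefficient of z^(2k) is E_(2k+nu). *)
Definition euler_series (nu : nat) : fps {poly rat} :=
  Fps (fun n => if odd n then 0 else euler_half (n + nu)).

Definition sigma (nu n : nat) : {poly rat} :=
  ((2 * n%:R + 1) * (n%:R + nu%:R / 2))%:P - (4 : rat)^-1 *: ('X ^+ 2 - 1).

Definition tau (nu n : nat) : {poly rat} :=
  (n%:R ^+ 2 / 4 : rat) *: ('X ^+ 2 - ((2 * n%:R + nu%:R - 1) ^+ 2)%:P).

Definition cf_num (nu n : nat) : fps {poly rat} :=
  if n is 0 then fpsC (euler_half nu) else fpsC (tau nu n) * fpsX _ ^+ 4.

Definition cf_den (nu n : nat) : fps {poly rat} :=
  1 + fpsC (sigma nu n) * fpsX _ ^+ 2.

(* No truncation of the continued fraction divides by a non-unit. *)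
Lemma cf_denom_unit (nu n k : nat) :
  cfrac_denom (cf_num nu) (cf_den nu) n k \is a GRing.unit.
Proof.
suff den0 : (cfrac_denom (cf_num nu) (cf_den nu) n k) 0 = 1.
  by rewrite fps_unitE den0 unitr1.
have X0 (f g : fps {poly rat}) m : (f * fpsX _ ^+ m.+1 * g) 0 = 0.
  by rewrite exprS mulrCA -mulrA fps_coefMX.
have b0 : cf_den nu n 0 = 1.
  by rewrite /cf_den fps_coefD -[X in _ + fps_coef X _]mulr1 X0 addr0.
by case: k => [//|k]; rewrite [LHS]fps_coefD b0 [X in _ + X]X0 addr0.
Qed.

(* Main.v *)
Require Import Defs.
From HB Require Import structures.
From mathcomp Require Import all_boot all_order all_algebra.
From mathcomp Require Import ring zify.

(** The fraction is the J-fraction of the continuous dual Hahn polynomials.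

    Put y = (x + 1) / 2 and let E be the umbral functional s^m |-> E_m(y) on
    polynomials in s.  The equation E_m(y + 1) + E_m(y) = 2 y^m, in the form
    E[q(s + 1) + q(s)] = 2 q(y) ([euler_umbral_shift]), evaluates E on any
    polynomial of the form q(s + 1) + q(s).  With a = nu / 2 and
    phi_k = prod_(j < k) ((a + j)^2 - s^2), the polynomials s^nu phi_k have
    this form for nu = 0, 1, with q an explicit product, while
    s^2 phi_k at a = 1 is -phi_(k+1) at a = 0; the outcome is
      E[s^nu phi_k] = E_nu(y) prod_(j < k) (a + y + j) (a + 1 - y + j),
    which is [even_umbral_basis].

    Let L be the functional f |-> E[s^nu f(s^2)] in the variable X = s^2.  The
    continuous dual Hahn polynomials Q_n with parameters a, b = y, c = 1 - y,
    made monic in X, are explicit combinations of the phi_k whose coefficients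
    alternate like binomial ones, so that L(Q_n) = 0 for n > 0
    ([dual_hahn_orthogonal]).  They satisfy
      Q_(n+1) = (X + sigma_n) Q_n + tau_n Q_(n-1)  ([dual_hahn_rec]).
    Apply L to this recurrence divided by 1 - z^2 X.  The series
    H_n = sum_k L(X^k Q_n) z^(2k) then satisfy
      z^2 H_(n+1) = (1 + sigma_n z^2) H_n + z^2 tau_n H_(n-1)   for n > 0,
      z^2 H_1 = (1 + sigma_0 z^2) H_0 - E_nu(y)
    ([dh_second_kind_rec]), and H_0 is the series to be expanded.  After
    rescaling by powers of -z^2 this is the recurrence
    a_n U_n = b_n U_(n+1) + U_(n+2) of the fraction, with U_0 = 1 and
    U_1 = H_0.  As in Pincherle's theorem, the error of the N-th truncation is
    a multiple of U_(N+2) = (-z^2)^(N+1) H_(N+1) ([cfrac_error]), hence tends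
    to 0. *)

Set Implicit Arguments.
Unset Strict Implicit.
Unset Printing Implicit Defensive.

Import GRing.Theory.
Local Open Scope ring_scope.

(** * Truncation error of a continued fraction *)

Section Pincherle.
Variables (K : comUnitRingType) (a b U : nat -> K).
Hypothesis U_rec : forall n, a n * U n = b n * U n.+1 + U n.+2.
Hypothesis den_unit : forall n k, cfrac_denom a b n k \is a GRing.unit.

(** The tail of the fraction at level n should be a_n U_n / U_(n+1).  Truncating
    at once leaves the defect - U_(n+2), by the recurrence; one more level
    multiplies the defect by minus the inverse of a denominator and shifts the
    index of U by one. *)
Lemma cfrac_denom_error n k :
  exists q, U n.+1 * cfrac_denom a b n k - a n * U n = U (n + k).+2 * q.
Proof.
elim: k n => [|k IHk] n /=; first by exists (-1); rewrite U_rec addn0; ring.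
have [q Hq] := IHk n.+1; rewrite addSnnS in Hq.
exists (- (q / cfrac_denom a b n.+1 k)).
have -> : U n.+1 * (b n + a n.+1 / cfrac_denom a b n.+1 k) - a n * U n
  = a n.+1 * U n.+1 / cfrac_denom a b n.+1 k - U n.+2.
  by rewrite U_rec; ring.
have -> : a n.+1 * U n.+1
  = U n.+2 * cfrac_denom a b n.+1 k - U (n + k.+1).+2 * q.
  by rewrite -Hq; ring.
by rewrite mulrBl mulrK // mulrN mulrA; ring.
Qed.

Lemma cfrac_error N : U 0 = 1 -> exists q, cfrac a b N - U 1 = U N.+2 * q.
Proof.
move=> U0; have [q] := cfrac_denom_error 0 N; rewrite U0 mulr1 add0n => Hq.
exists (- (q / cfrac_denom a b 0 N)).
have -> : U N.+2 * - (q / cfrac_denom a b 0 N)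
  = - (U N.+2 * q / cfrac_denom a b 0 N) by ring.
by rewrite -Hq /cfrac mulrBl mulrK //; ring.
Qed.

End Pincherle.

(** * Continuous dual Hahn polynomials *)

Section DualHahn.
Variables (R : comNzRingType) (a b c : R).

(** [dhA] and [dhC] are the coefficients A_n and C_n of the usual three-term
    recurrence -(a^2 + t^2) S_n = A_n S_(n+1) - (A_n + C_n) S_n + C_n S_(n-1)
    of the continuous dual Hahn polynomials S_n(t^2; a, b, c), divided by
    (a + b)_n (a + c)_n. *)
Definition dhA n : R := (a + b + n%:R) * (a + c + n%:R).
Definition dhC n : R := n%:R * (n%:R + b + c - 1).

(** With X = - t^2 this is (a + i t)_k (a - i t)_k, in which the
    hypergeometric series of the continuous dual Hahn polynomials is expanded. *)
Definition dh_basis k : {poly R} := \prod_(j < k) (((a + j%:R) ^+ 2)%:P - 'X).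

Definition dh_coef n m : R :=
  (-1) ^+ m * 'C(n, m)%:R * \prod_(m <= j < n) dhA j.

(** This is (a + b)_n (a + c)_n 3F2(-n, a + i t, a - i t; a + b, a + c; 1) at
    X = - t^2, with the Pochhammer factors multiplied in, so that no division
    occurs and the polynomial is monic in X. *)
Definition dual_hahn n : {poly R} := \sum_(m < n.+1) dh_coef n m *: dh_basis m.

Lemma dh_basisS k : dh_basis k.+1 = dh_basis k * (((a + k%:R) ^+ 2)%:P - 'X).
Proof. by rewrite /dh_basis big_ord_recr. Qed.

Lemma dh_coef_small n m : (n < m)%N -> dh_coef n m = 0.
Proof. by move=> lt_nm; rewrite /dh_coef bin_small // mulr0 mul0r. Qed.

Lemma dual_hahn_widen n N : (n < N)%N ->
  dual_hahn n = \sum_(m < N) dh_coef n m *: dh_basis m.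
Proof.
move=> lt_nN; rewrite /dual_hahn.
rewrite (big_ord_widen N (fun m => dh_coef n m *: dh_basis m)) // big_mkcond.
apply: eq_bigr => m _; case: ifPn => //; rewrite -leqNgt => lt_nm.
by rewrite dh_coef_small // scale0r.
Qed.

(** Clearing n 'C(n - 1, m) = (n - m) 'C(n, m) expresses the term of index
    n - 1 in the recurrence by a coefficient of index n, without a case split
    on n or on m = n. *)
Lemma dh_coef_lower n m : (m <= n)%N ->
  dhA n.-1 * dhC n * dh_coef n.-1 m
    = (n%:R - m%:R) * (n%:R + b + c - 1) * dh_coef n m.
Proof.
rewrite leq_eqVlt => /predU1P[->|].
  case: n => [|n]; first by rewrite /dhC !(mul0r, mulr0, subrr).
  by rewrite dh_coef_small // subrr !(mul0r, mulr0).
case: n => // n; rewrite ltnS => le_mn /=.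
rewrite /dh_coef big_nat_recr //=.
have bin : (n.+1%:R - m%:R) * 'C(n.+1, m)%:R = n.+1%:R * 'C(n, m)%:R :> R.
  by rewrite -natrB ?(leqW le_mn) // -!natrM mul_bin_down.
rewrite /dhC; set P := \prod_(_ <= _ < _) _.
transitivity (n.+1%:R * 'C(n, m)%:R * ((n.+1%:R + b + c - 1) * dhA n * P * (-1) ^+ m)).
  by ring.
by rewrite -bin; ring.
Qed.

(** Multiplication by X maps phi_m to (a + m)^2 phi_m - phi_(m+1), so this is the
    coefficient of phi_m in the three-term recurrence. *)
Lemma dh_coef_rec n m :
  dh_coef n.+1 m = ((a + m%:R) ^+ 2 + (dhA n + dhC n - a ^+ 2)) * dh_coef n m
    - (if m is p.+1 then dh_coef n p else 0)
    - dhA n.-1 * dhC n * dh_coef n.-1 m.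
Proof.
have [le_mn|lt_nm] := leqP m n; last first.
  rewrite [dh_coef n m]dh_coef_small // [dh_coef n.-1 m]dh_coef_small; last first.
    exact: leq_ltn_trans (leq_pred _) lt_nm.
  rewrite !mulr0 subr0 add0r; case: m lt_nm => // m; rewrite ltnS => le_nm.
  move: le_nm; rewrite leq_eqVlt => /predU1P[<-|lt_nm].
    by rewrite /dh_coef !big_geq // !binn exprS; ring.
  by rewrite !dh_coef_small ?ltnS // oppr0.
rewrite dh_coef_lower //; case: m le_mn => [|p] le_mn.
  rewrite /dh_coef big_nat_recr //= !bin0 /dhC; ring.
have -> : dh_coef n p =
  - (-1) ^+ p.+1 * 'C(n, p)%:R * dhA p * \prod_(p.+1 <= j < n) dhA j.
  by rewrite /dh_coef [in LHS]big_ltn // exprS; ring.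
rewrite /dh_coef big_nat_recr //= binS natrD.
have bin : p.+1%:R * 'C(n, p.+1)%:R = (n%:R - p%:R) * 'C(n, p)%:R :> R.
  by rewrite -natrB ?(ltnW le_mn) // -!natrM mul_bin_left.
set P := \prod_(_ <= _ < _) _.
set u := 'C(n, p)%:R in bin *; set v := 'C(n, p.+1)%:R in bin *.
apply/eqP; rewrite -subr_eq0; apply/eqP.
(* Both sides differ by a multiple of the binomial identity [bin]; the
   cofactor comes from A_n - A_p = (n - p) (n + p + 2 a + b + c). *)
transitivity ((-1) ^+ p.+1 * P * (n%:R + p.+1%:R + a + a + b + c - 1) *
  ((n%:R - p%:R) * u - p.+1%:R * v)); last by rewrite bin subrr mulr0.
by rewrite /dhA /dhC; ring.
Qed.

(** For n = 0 the index n.-1 is harmless, because [dhC 0] = 0. *)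
Lemma dual_hahn_rec n :
  dual_hahn n.+1 = ('X + (dhA n + dhC n - a ^+ 2)%:P) * dual_hahn n
                     - (dhA n.-1 * dhC n) *: dual_hahn n.-1.
Proof.
rewrite !(@dual_hahn_widen _ n.+2) // ?(leq_ltn_trans (leq_pred _)) //.
have -> : \sum_(m < n.+2) dh_coef n.+1 m *: dh_basis m =
  \sum_(m < n.+2) ((a + m%:R) ^+ 2 + (dhA n + dhC n - a ^+ 2)) * dh_coef n m *: dh_basis m
  - \sum_(m < n.+2) (if val m is p.+1 then dh_coef n p else 0) *: dh_basis m
  - (dhA n.-1 * dhC n) *: \sum_(m < n.+2) dh_coef n.-1 m *: dh_basis m.
  rewrite scaler_sumr -!sumrB; apply: eq_bigr => m _.
  by rewrite dh_coef_rec !scalerBl scalerA.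
congr (_ - _).
rewrite [X in _ - X]big_ord_recl /= scale0r add0r big_ord_recr /=.
rewrite [in RHS]big_ord_recr /= [dh_coef n n.+1]dh_coef_small //.
rewrite mulr0 !scale0r !addr0 mulr_sumr -sumrB; apply: eq_bigr => m _.
rewrite dh_basisS -!mul_polyC !(polyCM, polyCD) /=; ring.
Qed.

Variable L : {scalar {poly R}}.
Hypothesis L_basis : forall k, L (dh_basis k) = L 1 * \prod_(j < k) dhA j.

(** On the expansion of Q_n the values L(phi_m) complete the products of the
    coefficients to one common product, which leaves
    sum_m (-1)^m 'C(n, m) = 0^n. *)
Lemma dual_hahn_orthogonal n : L (dual_hahn n) = L 1 *+ (n == 0)%N.
Proof.
rewrite /dual_hahn linear_sum /=.
transitivity (L 1 * \prod_(0 <= j < n) dhA j * \sum_(m < n.+1) (-1) ^+ m *+ 'C(n, m)).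
  rewrite mulr_sumr; apply: eq_bigr => m _.
  rewrite scalarZ L_basis /dh_coef -(big_mkord xpredT dhA).
  rewrite (@big_cat_nat _ _ _ m 0 n) //=; last by rewrite -ltnS.
  rewrite -mulr_natr; ring.
have -> : \sum_(m < n.+1) (-1) ^+ m *+ 'C(n, m) = (0 : R) ^+ n.
  transitivity ((1 - 1 : R) ^+ n); last by rewrite subrr.
  rewrite exprDn.
  by apply: eq_bigr => m _; rewrite expr1n mul1r.
case: n => [|n]; first by rewrite big_geq // expr0 !mulr1.
by rewrite expr0n mulr0.
Qed.

(** The function of the second kind L(Q_n / (1 - z^2 X)). *)
Definition dh_second_kind n : fps R :=
  Fps (fun j => if odd j then 0 else L ('X^(j./2) * dual_hahn n)).

Lemma fps_coefCM (r : R) f j : (fpsC r * f) j = r * f j.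
Proof.
rewrite fps_coefM big_ord_recl subn0 /= big1 ?addr0 // => i _.
by rewrite mulr0n mul0r.
Qed.

(** Since z^2 X / (1 - z^2 X) = 1 / (1 - z^2 X) - 1, the factor X of the
    recurrence costs L(Q_n), which vanishes unless n = 0. *)
Lemma dh_second_kind_rec n :
  fpsX R ^+ 2 * dh_second_kind n.+1 =
    (1 + fpsC (dhA n + dhC n - a ^+ 2) * fpsX R ^+ 2) * dh_second_kind n
    - fpsC (dhA n.-1 * dhC n) * fpsX R ^+ 2 * dh_second_kind n.-1
    - fpsC (L 1 *+ (n == 0)%N).
Proof.
set s := dhA n + _ - _; set t := dhA n.-1 * _.
rewrite mulrDl mul1r expr2 -!mulrA.
apply: fpsP => j.
rewrite !(fps_coefD, fps_coefN) !fps_coefCM.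
rewrite !fps_coefMX; case: j => [|[|j]]; rewrite ?fps_coefMX /=.
- by rewrite mul1r dual_hahn_orthogonal; ring.
- by rewrite mulr0n; ring.
rewrite mulr0n negbK; case: ifP => _; first by ring.
rewrite dual_hahn_rec -/s -/t.
have -> : 'X^(j./2) * (('X + s%:P) * dual_hahn n - t *: dual_hahn n.-1) =
  'X^(j./2.+1) * dual_hahn n + s *: ('X^(j./2) * dual_hahn n)
   - t *: ('X^(j./2) * dual_hahn n.-1).
  by rewrite -!mul_polyC exprS; ring.
by rewrite linearB linearD !scalarZ; ring.
Qed.

End DualHahn.

(** * Umbral functionals *)

Section Umbral.
Variables (R : comNzRingType) (e : nat -> R).

Definition umbral (p : {poly R}) : R := \sum_(i < size p) p`_i * e i.

Lemma umbral_widen (p : {poly R}) N :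
  (size p <= N)%N -> umbral p = \sum_(i < N) p`_i * e i.
Proof.
move=> le_pN; rewrite /umbral (big_ord_widen N (fun i => p`_i * e i)) // big_mkcond.
apply: eq_bigr => i _; case: ifPn => //; rewrite -leqNgt => le_pi.
by rewrite nth_default // mul0r.
Qed.

Fact umbral_is_scalar : scalar umbral.
Proof.
move=> r p q; pose N := maxn (size p) (size q).
rewrite !(@umbral_widen _ N) ?leq_maxl ?leq_maxr //; last first.
  by rewrite (leq_trans (size_polyD _ _)) // geq_max leq_maxr
    (leq_trans (size_scale_leq _ _)) ?leq_maxl.
rewrite mulr_sumr -big_split; apply: eq_bigr => i _ /=.
by rewrite coefD coefZ mulrDl mulrA.
Qed.

HB.instance Definition _ :=
  GRing.isLinear.Build R {poly R} R *%R umbral umbral_is_scalar.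

Lemma umbralXn n : umbral 'X^n = e n.
Proof.
rewrite /umbral size_polyXn big_ord_recr /= coefXn eqxx mul1r big1 ?add0r //.
by move=> i _; rewrite coefXn ltn_eqF // mul0r.
Qed.

End Umbral.

Section EvenPart.
Variables (R : comNzRingType) (e : nat -> R) (nu : nat).

(** The even polynomials times s^nu, seen as polynomials in s^2: the moments of
    this functional are the e_(2k + nu) only. *)
Definition even_umbral (p : {poly R}) : R := umbral e ('X^nu * (p \Po 'X^2)).

Fact even_umbral_is_scalar : scalar even_umbral.
Proof.
move=> r p q; rewrite /even_umbral linearP /= mulrDr -scalerAr.
exact: umbral_is_scalar.
Qed.

HB.instance Definition _ :=
  GRing.isLinear.Build R {poly R} R *%R even_umbral even_umbral_is_scalar.

Lemma even_umbralXn k : even_umbral 'X^k = e (k.*2 + nu).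
Proof.
by rewrite /even_umbral comp_Xn_poly -exprM -exprD umbralXn addnC mul2n.
Qed.

End EvenPart.

(** * Writing the basis as q(s + 1) + q(s) *)

Section ShiftedBasis.
Variables (R : comNzRingType) (a : R).

(** With rising factorials, (s + a)_k (a + 1 - s)_k: the shift s -> s + 1 moves
    it to (s + a + 1)_k (a - s)_k, and both arise from (a + s)_k (a - s)_k by
    exchanging one end factor. *)
Definition shift_basis k : {poly R} :=
  \prod_(j < k) (('X + (a + j%:R)%:P) * ((a + 1 + j%:R)%:P - 'X)).

Lemma shift_basis_up k :
  ('X + a%:P) * (shift_basis k \Po ('X + 1))
    = ('X + (a + k%:R)%:P) * (dh_basis a k \Po 'X^2).
Proof.
elim: k => [|k IHk].
  by rewrite /shift_basis /dh_basis !big_ord0 addr0 !rmorph1.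
rewrite dh_basisS /shift_basis big_ord_recr /= -/(shift_basis k).
rewrite (comp_polyM (shift_basis k)) mulrA IHk (comp_polyM (dh_basis a k)).
rewrite comp_polyM !comp_polyB comp_polyD !comp_polyC !comp_polyX.
rewrite !(rmorphXn, rmorphD) /= -natr1 !rmorphD /= !rmorph1; ring.
Qed.

Lemma shift_basis_down k :
  (a%:P - 'X) * shift_basis k
    = ((a + k%:R)%:P - 'X) * (dh_basis a k \Po 'X^2).
Proof.
elim: k => [|k IHk].
  by rewrite /shift_basis /dh_basis !big_ord0 addr0 !rmorph1.
rewrite dh_basisS /shift_basis big_ord_recr /= -/(shift_basis k).
rewrite mulrA IHk comp_polyM comp_polyB comp_polyC comp_polyX.
rewrite !(rmorphXn, rmorphD) /= -natr1 !rmorphD /= !rmorph1; ring.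
Qed.

Lemma shift_basis_sum k :
  ('X + a%:P) * (shift_basis k \Po ('X + 1)) + ('X - a%:P) * shift_basis k
    = 'X * (dh_basis a k \Po 'X^2) *+ 2.
Proof.
have -> : ('X - a%:P) * shift_basis k = - ((a%:P - 'X) * shift_basis k) by ring.
by rewrite shift_basis_up shift_basis_down polyCD; ring.
Qed.

Lemma horner_shift_basis k y :
  (shift_basis k).[y] = \prod_(j < k) dhA a y (1 - y) j.
Proof.
rewrite horner_prod; apply: eq_bigr => j _.
by rewrite hornerM !hornerD hornerN hornerX !hornerC /dhA; ring.
Qed.

End ShiftedBasis.

(** * Euler polynomials as moments *)

Lemma euler_poly_shift n :
  \sum_(i < n.+1) euler_poly i *+ 'C(n, i) + euler_poly n = 2 * 'X ^+ n.
Proof.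
have := congr1 (fun f : fps {poly rat} => (n`!%:R : rat) *: f n) euler_gfP.
have -> : ((n`!%:R : rat) *: (2 * fps_exp 'X : fps _) n) = 2 * 'X ^+ n.
  have -> : (2 : fps {poly rat}) = 1 + 1 by [].
  rewrite mulrDl mul1r fps_coefD /= scalerDr scalerA divff ?scale1r; first by ring.
  by rewrite Num.Theory.pnatr_eq0 -lt0n fact_gt0.
move=> <-; rewrite mulrDr mulr1 fps_coefD scalerDr; congr (_ + _); last first.
  by rewrite /= scalerA divff ?scale1r // Num.Theory.pnatr_eq0 -lt0n fact_gt0.
rewrite fps_coefM scaler_sumr; apply: eq_bigr => i _ /=.
move: (euler_poly i) => Ei.
rewrite expr1n -scalerAl -scalerAr mulr1 !scalerA -scaler_nat; congr (_ *: _).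
have le_in : (i <= n)%N by rewrite -ltnS.
rewrite -(bin_fact le_in) !natrM; field.
by rewrite !Num.Theory.pnatr_eq0 -!lt0n !fact_gt0.
Qed.

Local Notation y := ((2 : rat)^-1 *: ('X + 1) : {poly rat}).
Local Notation E := (umbral euler_half).

Lemma euler_umbral_shift (q : {poly {poly rat}}) :
  E (q \Po ('X + 1)) + E q = 2 * q.[y].
Proof.
rewrite -[q]coefK poly_def !linear_sum /= horner_sum mulr_sumr -big_split.
apply: eq_bigr => n _ /=.
rewrite linearZ /= !scalarZ comp_Xn_poly hornerZ hornerXn /= umbralXn.
rewrite mulrCA -mulrDr; congr (_ * _).
rewrite exprD1n linear_sum /=.
have -> : 2 * y ^+ n = (2 * 'X ^+ n) \Po y.
  by rewrite rmorphM rmorph_nat /= comp_Xn_poly.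
rewrite -euler_poly_shift rmorphD /= rmorph_sum /=; congr (_ + _).
by apply: eq_bigr => i _; rewrite !raddfMn /= umbralXn.
Qed.

Lemma poly_rat_mul2I : injective ( *%R (2 : {poly rat})).
Proof. by apply: mulfI; rewrite -polyC_natr polyC_eq0. Qed.

(** At a = 0, [shift_basis_sum] has a factor s on both sides; cancelling it
    leaves q(s + 1) + q(s) = 2 phi_k. *)
Lemma euler_umbral_basis0 k :
  E (dh_basis 0 k \Po 'X^2) = \prod_(j < k) dhA 0 y (1 - y) j.
Proof.
rewrite -horner_shift_basis; apply: poly_rat_mul2I.
rewrite -euler_umbral_shift mulr_natl -raddfMn -raddfD /=; congr (E _).
apply: (mulfI (negbT (polyX_eq0 _))).
have := shift_basis_sum (0 : {poly rat}) k.
by rewrite rmorph0 addr0 subr0 -mulrDr -mulrnAr.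
Qed.

Local Notation h := ((2 : rat)^-1%:P : {poly rat}).

(** The factor s - 1/2 becomes s + 1/2 under the shift, so [shift_basis_sum] at
    a = 1/2 gives 2 s phi_k for q = (s - 1/2) (s + 1/2)_k (3/2 - s)_k. *)
Lemma euler_umbral_basis1 k :
  E ('X * (dh_basis h k \Po 'X^2)) = (y - h) * \prod_(j < k) dhA h y (1 - y) j.
Proof.
rewrite -horner_shift_basis; apply: poly_rat_mul2I.
have -> : (y - h) * (shift_basis h k).[y] = (('X - h%:P) * shift_basis h k).[y].
  by rewrite hornerM hornerXsubC.
rewrite -euler_umbral_shift mulr_natl -raddfMn -raddfD /=; congr (E _).
have hh : h%:P = 1 - h%:P :> {poly {poly rat}}.
  by apply: (canRL (addrK _)); rewrite -!polyCD (_ : 2^-1 + 2^-1 = 1 :> rat).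
rewrite comp_polyM comp_polyB comp_polyX comp_polyC.
by rewrite -addrA -hh shift_basis_sum.
Qed.

Lemma dh_basis_recl (R : comNzRingType) (a : R) k :
  dh_basis a k.+1 = ((a ^+ 2)%:P - 'X) * dh_basis (a + 1) k.
Proof.
rewrite /dh_basis big_ord_recl addr0; congr (_ * _); apply: eq_bigr => j _.
by rewrite /bump /= natrD addrA.
Qed.

Lemma dhA_shift (R : comNzRingType) (a b c : R) n :
  dhA (a + 1) b c n = dhA a b c n.+1.
Proof. by rewrite /dhA -natr1; ring. Qed.

(** Reduces to a = 0, the first factor of phi_(k+1) there being - s^2. *)
Lemma euler_umbral_basis2 k :
  E ('X^2 * (dh_basis 1 k \Po 'X^2)) =
    - dhA 0 y (1 - y) 0 * \prod_(j < k) dhA 1 y (1 - y) j.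
Proof.
have -> : 'X^2 * (dh_basis 1 k \Po 'X^2) = - (dh_basis (0 : {poly rat}) k.+1 \Po 'X^2).
  rewrite dh_basis_recl comp_polyM comp_polyB comp_polyX comp_polyC.
  by rewrite [0 + 1]add0r expr0n rmorph0; ring.
rewrite raddfN /= euler_umbral_basis0 big_ord_recl mulNr; congr (- (_ * _)).
by apply: eq_bigr => j _; rewrite lift0 -dhA_shift add0r.
Qed.

Local Notation par nu := ((nu%:R / 2 : rat)%:P).

(** The three cases give the product up to a factor free of k; at k = 0 this
    factor is the moment of 1. *)
Lemma even_umbral_basis nu k : (nu <= 2)%N ->
  even_umbral euler_half nu (dh_basis (par nu) k) =
   even_umbral euler_half nu 1 * \prod_(j < k) dhA (par nu) y (1 - y) j.
Proof.
move=> le_nu2.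
suff [r Er] : exists r, forall k, even_umbral euler_half nu (dh_basis (par nu) k)
    = r * \prod_(j < k) dhA (par nu) y (1 - y) j.
  have := Er 0; rewrite /dh_basis !big_ord0 mulr1 => ->; exact: Er.
case: nu le_nu2 => [|[|[|//]]] _.
- exists 1 => j; rewrite mul0r polyC0 mul1r /even_umbral mul1r.
  exact: euler_umbral_basis0.
- exists (y - h) => j; rewrite mul1r; exact: euler_umbral_basis1.
exists (- dhA 0 y (1 - y) 0) => j; rewrite divff //; exact: euler_umbral_basis2.
Qed.

Lemma quarter_scale (p : {poly rat}) : (4 : rat)^-1 *: (4 * p) = p.
Proof. by rewrite mulr_natl -scaler_nat scalerA mulVf ?scale1r. Qed.

Lemma polyX_y : 'X = y + y - 1 :> {poly rat}.
Proof.
by rewrite -scalerDl (_ : 2^-1 + 2^-1 = 1 :> rat) // scale1r addrK.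
Qed.

(** * The continued fraction *)

Lemma sigma_dual_hahn nu n :
  sigma nu n = dhA (par nu) y (1 - y) n + dhC y (1 - y) n - par nu ^+ 2.
Proof.
rewrite /sigma; move: polyX_y; set z := y => ->.
have -> : (z + z - 1) ^+ 2 - 1 = 4 * (z ^+ 2 - z) by ring.
rewrite quarter_scale; move: (nu%:R / 2) => a0.
rewrite polyCM !(polyCD, polyCM) !polyC_natr polyC1 /dhA /dhC; ring.
Qed.

Lemma tau_dual_hahn nu n :
  tau nu n.+1 = - (dhA (par nu) y (1 - y) n * dhC y (1 - y) n.+1).
Proof.
rewrite /tau; move: polyX_y; set z := y => ->.
have -> : 2 * n.+1%:R + nu%:R - 1 = 2 * n.+1%:R + (nu%:R / 2 + nu%:R / 2) - 1 :> rat.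
  by field.
move: (nu%:R / 2) => a0.
rewrite mulrC -scalerA.
have -> : (z + z - 1) ^+ 2 - ((2 * n.+1%:R + (a0 + a0) - 1) ^+ 2)%:P =
   4 * ((z - n.+1%:R - a0%:P) * (z + n.+1%:R + a0%:P - 1)).
  by rewrite rmorphXn /= !(polyCB, polyCD, polyCM) !polyC_natr polyC1; ring.
rewrite scalerAr quarter_scale -mul_polyC rmorphXn /= polyC_natr /dhA /dhC -natr1; ring.
Qed.

Lemma fpsCN (R : comNzRingType) (r : R) : fpsC (- r) = - fpsC r.
Proof. by apply: fpsP => n; rewrite /= mulNrn. Qed.

Theorem lemma5p3 (nu : nat) (hnu : (nu <= 2)%N) :
  fps_cvg (fun N : nat => cfrac (cf_num nu) (cf_den nu) N) (euler_series nu).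
Proof.
pose L : {scalar {poly {poly rat}}} := even_umbral euler_half nu.
pose H := dh_second_kind (par nu) y (1 - y) L.
(* H_n has the factor (-z^2)^n in the sequence U: each level of the fraction
   contributes z^4 against the z^2 of the recurrence of H. *)
pose T : fps {poly rat} := - fpsX _ ^+ 2.
pose U n := if n is m.+1 then T ^+ m * H m else 1.
have L1 : L 1 = euler_half nu.
  by have := even_umbralXn euler_half nu 0; rewrite expr0.
have fpsC0 : fpsC (0 : {poly rat}) = 0.
  by apply: fpsP => j; rewrite /= mul0rn.
have H_rec n : fpsX _ ^+ 2 * H n.+1 = cf_den nu n * H n
    - fpsC (dhA (par nu) y (1 - y) n.-1 * dhC y (1 - y) n) * fpsX _ ^+ 2 * H n.-1
    - fpsC (euler_half nu *+ (n == 0)%N).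
  rewrite -L1 /cf_den sigma_dual_hahn; apply: dh_second_kind_rec => k.
  exact: even_umbral_basis.
have U_rec n : cf_num nu n * U n = cf_den nu n * U n.+1 + U n.+2.
  case: n => [|n].
    rewrite /= expr0 mul1r mulr1 expr1 mulNr H_rec /dhC !(mul0r, mulr0) mulr1n.
    by rewrite fpsC0; ring.
  have -> : U n.+3 = - (T ^+ n.+1 * (fpsX _ ^+ 2 * H n.+2)).
    by rewrite /U exprS /T; ring.
  rewrite H_rec mulr0n fpsC0 /= tau_dual_hahn fpsCN [T ^+ n.+1]exprS.
  by move: (T ^+ n) (cf_den _ _) (fpsC _) => V D r; rewrite /T; ring.
have H0 : H 0 = euler_series nu.
  apply: fpsP => j /=; case: ifPn => // j_even.
  rewrite /dual_hahn big_ord1 /dh_coef big_geq // /dh_basis big_ord0 bin0.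
  rewrite expr0 !mulr1 scale1r mulr1.
  by rewrite [LHS]even_umbralXn even_halfK.
move=> n; exists n => N le_nN.
have [q Hq] := cfrac_error U_rec (cf_denom_unit nu) N erefl.
have le_n : (n <= 2 * N.+1)%N by lia.
exists (fpsX _ ^+ (2 * N.+1 - n) * ((-1) ^+ N.+1 * H N.+1 * q)).
rewrite mulrA -exprD subnKC // -H0; move: Hq; rewrite /U expr0 mul1r => ->.
have -> : T ^+ N.+1 = fpsX _ ^+ (2 * N.+1) * (-1) ^+ N.+1.
  by rewrite /T [LHS]exprNn exprM mulrC.
by rewrite -!mulrA.
Qed.
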